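(* Let $U \subset \mathbb{R}^n$ be an open convex set and let $f \colon U \to \mathbb{R}$ be a convex function. Suppose $(x_k)_{k\ge 0}$ is a BFGS sequence for $f$ contained in $U$, and that the level set $\{x \in U : f(x) \le f(x_0)\}$ is bounded. Assume that there is an open set $V \subset U$ containing the closure $\mathrm{cl}\,\{x_k : k \ge 0\}$ of the sequence, satisfying $\inf_{x\in V} f(x) = \min f$, such that the Hessian $\nabla^2 f$ exists, is positive definite, and is continuous throughout $V$. Then the sequence of function values $f(x_k)$ converges to $\min f$.
   Context: Here $\min f$ denotes the minimum (infimum) value of $f$ over $U$. A sequence $(x_k)$ is a BFGS sequence for $f$ if $f$ is differentiable at each $x_k$ with $\nabla f(x_k) \neq 0$, and there exist parameters $0<\mu<\nu<1$ and a positive definite $n\times n$ matrix $H_0$ such that, with $s_k = x_{k+1}-x_k$, $y_k = \nabla f(x_{k+1}) - \nabla f(x_k)$, $V_k = I - \frac{s_k y_k^T}{s_k^T y_k}$ and $H_{k+1} = V_k H_k V_k^T + \frac{s_k s_k^T}{s_k^T y_k}$, one has for all $k=0,1,2,\dots$: $H_k \nabla f(x_k) \in -\mathbb{R}_+ s_k$, $f(x_{k+1}) \le f(x_k) + \mu \nabla f(x_k)^T s_k$ (Armijo condition), and $\nabla f(x_{k+1})^T s_k \ge \nu \nabla f(x_k)^T s_k$ (weak Wolfe condition). *)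

(* Defs.v *)
From HB Require Import structures.
From mathcomp Require Import all_boot all_order all_algebra.
From mathcomp Require Import all_classical all_reals all_analysis.
Set Implicit Arguments. Unset Strict Implicit. Unset Printing Implicit Defensive.
Import Order.TTheory GRing.Theory Num.Theory.
Import numFieldNormedType.Exports.
Local Open Scope classical_set_scope.
Local Open Scope ring_scope.

Section Defs.
Variables (R : realType) (n : nat).
Local Notation vec := 'rV[R]_n.

Definition ebasis (i : 'I_n) : vec := delta_mx 0 i.

Definition grad (f : vec -> R) (x : vec) : vec :=
  \row_i ('D_(ebasis i) f x).

Definition hessian (f : vec -> R) (x : vec) : 'M[R]_n :=
  \matrix_(i, j) ('D_(ebasis j) ('D_(ebasis i) f) x).

Definition hessian_exists (f : vec -> R) (x : vec) : Prop :=
  (forall i, derivable f x (ebasis i)) /\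
  (forall i j, derivable ('D_(ebasis i) f) x (ebasis j)).

Definition posdef (A : 'M[R]_n) : Prop :=
  A^T = A /\ forall v : vec, v != 0 -> 0 < (v *m A *m v^T) 0 0.

Definition dotv (u v : vec) : R := (u *m v^T) 0 0.

(** BFGS inverse-Hessian approximations H_k generated from H_0 along x *)
Fixpoint bfgsH (f : vec -> R) (x : nat -> vec) (H0 : 'M[R]_n) (k : nat)
  : 'M[R]_n :=
  match k with
  | 0%N => H0
  | k'.+1 =>
    let s := x k'.+1 - x k' in
    let y := grad f (x k'.+1) - grad f (x k') in
    let Vk := 1%:M - (dotv s y)^-1 *: (s^T *m y) in
    Vk *m bfgsH f x H0 k' *m Vk^T + (dotv s y)^-1 *: (s^T *m s)
  end.

Definition BFGS_sequence (f : vec -> R) (x : nat -> vec) : Prop :=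
  (forall k, differentiable f (x k) /\ grad f (x k) != 0) /\
  exists (mu nu : R) (H0 : 'M[R]_n),
    [/\ 0 < mu, mu < nu, nu < 1, posdef H0 &
    forall k,
      let s := x k.+1 - x k in
      [/\ exists t : R, 0 <= t /\
            bfgsH f x H0 k *m (grad f (x k))^T = - (t *: s^T),
          f (x k.+1) <= f (x k) + mu * dotv (grad f (x k)) s &
          dotv (grad f (x k.+1)) s >= nu * dotv (grad f (x k)) s]].

End Defs.

(* Main.v *)
(* The gradient inequality for convex functions reduces the claim to
   liminf |grad f (x_k)| = 0, because the level set is bounded.

   On the compact closure of the sequence the Hessian is bounded, which gives a
   uniform quadratic upper model of f around each x_k (averaging over the
   coordinate directions by convexity, so that only diagonal entries of the
   Hessian are needed). Comparing the model at x_k with the supporting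
   hyperplane at x_{k+1} yields |y_k|^2 <= C s_k.y_k, even though the segment
   from x_k to x_{k+1} may leave V.

   Powell's argument then applies to B_k = H_k^-1. Write s_k B_k = - la_k g_k
   and a_k = - g_k.s_k > 0. The trace of B_k grows at most linearly while
   losing la_k |g_k|^2 / a_k at each step, and its determinant is multiplied by
   s_k.y_k / (la_k a_k) >= (1 - nu) / la_k. If |g_k| stayed away from 0, the
   arithmetic-geometric mean inequality would give a geometric lower bound on
   a_0 ... a_{k-1}, which is incompatible with the convergence of sum a_k
   (a consequence of the Armijo condition). *)

Require Import Defs.
From HB Require Import structures.
From mathcomp Require Import all_boot all_order all_algebra.
From mathcomp Require Import all_classical all_reals all_analysis.
From mathcomp Require Import perm ring lra zify.
Import Order.TTheory GRing.Theory Num.Theory.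
Import numFieldNormedType.Exports.
Local Open Scope classical_set_scope.
Local Open Scope ring_scope.

Set Implicit Arguments.
Unset Strict Implicit.
Unset Printing Implicit Defensive.

(** * Linear algebra of the BFGS update *)

Section Dotv.
Variables (R : realType) (n : nat).
Implicit Types (u v w : 'rV[R]_n) (a : R).

Lemma dotvE u v : dotv u v = \sum_i u 0 i * v 0 i.
Proof. by rewrite /dotv mxE; apply: eq_bigr => i _; rewrite mxE. Qed.

Lemma dotvC u v : dotv u v = dotv v u.
Proof. by rewrite !dotvE; apply: eq_bigr => i _; rewrite mulrC. Qed.

Lemma dotvDl u v w : dotv (u + v) w = dotv u w + dotv v w.
Proof. by rewrite /dotv mulmxDl mxE. Qed.

Lemma dotvZl a u v : dotv (a *: u) v = a * dotv u v.
Proof. by rewrite /dotv -scalemxAl mxE. Qed.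

Lemma dotvNl u v : dotv (- u) v = - dotv u v.
Proof. by rewrite -scaleN1r dotvZl mulN1r. Qed.

Lemma dotvBl u v w : dotv (u - v) w = dotv u w - dotv v w.
Proof. by rewrite dotvDl dotvNl. Qed.

Lemma dotvDr u v w : dotv u (v + w) = dotv u v + dotv u w.
Proof. by rewrite dotvC dotvDl !(dotvC _ u). Qed.

Lemma dotvZr a u v : dotv u (a *: v) = a * dotv u v.
Proof. by rewrite dotvC dotvZl dotvC. Qed.

Lemma dotvNr u v : dotv u (- v) = - dotv u v.
Proof. by rewrite dotvC dotvNl dotvC. Qed.

Lemma dotvBr u v w : dotv u (v - w) = dotv u v - dotv u w.
Proof. by rewrite dotvDr dotvNr. Qed.

Lemma dotv_ebasis u i : dotv u (ebasis _ i) = u 0 i.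
Proof.
rewrite dotvE (bigD1 i) //= big1 ?addr0 ?mxE ?eqxx ?mulr1 //.
by move=> j ji; rewrite mxE (negbTE ji) andbF mulr0.
Qed.

Lemma dotvv_ge0 u : 0 <= dotv u u.
Proof. by rewrite dotvE; apply: sumr_ge0 => i _; rewrite -expr2 sqr_ge0. Qed.

Lemma sqr_coord_le_dotvv u i : u 0 i ^+ 2 <= dotv u u.
Proof.
rewrite dotvE (bigD1 i) //= -expr2 lerDl.
by apply: sumr_ge0 => j _; rewrite -expr2 sqr_ge0.
Qed.

Lemma mulmx_dotv u v : u *m v^T = (dotv u v)%:M.
Proof. by rewrite [LHS]mx11_scalar. Qed.

Lemma outerE u v i j : (u^T *m v) i j = u 0 i * v 0 j.
Proof. by rewrite mxE big_ord1 mxE. Qed.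

Lemma outer_mulmx u v w (z : 'rV[R]_n) :
  (u^T *m v) *m (w^T *m z) = dotv v w *: (u^T *m z).
Proof. by rewrite mulmxA -(mulmxA u^T) mulmx_dotv mul_mx_scalar -scalemxAl. Qed.

Lemma mxtrace_outer u v : \tr (u^T *m v) = dotv u v.
Proof. by rewrite dotvE; apply: eq_bigr => i _; rewrite outerE. Qed.

(** Matrix determinant lemma: the bordered matrix [M] is reduced to block triangular form in two
    ways, by unimodular factors, and its two Schur complements have the same determinant. *)
Lemma det_rank_one_update u v : \det (1%:M + u^T *m v) = 1 + dotv v u.
Proof.
pose M := block_mx (1%:M : 'M[R]_1) (- v) u^T (1%:M : 'M[R]_n).
have E1 : block_mx 1%:M 0 (- u^T) 1%:M *m M
        = block_mx 1%:M (- v) 0 (1%:M + u^T *m v).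
  rewrite mulmx_block !mul1mx !mul0mx !mulmx1 !addr0 mulNmx mulmxN opprK addNr.
  by rewrite addrC.
have E2 : block_mx 1%:M v 0 1%:M *m M
        = block_mx ((1 + dotv v u)%:M) 0 u^T 1%:M.
  rewrite mulmx_block !mul1mx !mul0mx !mulmx1 !add0r addNr mulmx_dotv.
  by rewrite -raddfD.
have := congr1 determinant E1; rewrite det_mulmx det_lblock det_ublock !det1.
rewrite !mul1r => <-; have := congr1 determinant E2.
by rewrite det_mulmx det_lblock det_ublock !det1 !mul1r mulr1 det_scalar1.
Qed.

Lemma dotv_norm_le u v (M : R) :
  (forall i, `|v 0 i| <= M) -> `|dotv u v| <= (\sum_i `|u 0 i|) * M.
Proof.
move=> vM; rewrite dotvE mulr_suml; apply: le_trans (ler_norm_sum _ _ _) _.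
by apply: ler_sum => i _; rewrite normrM ler_wpM2l.
Qed.

End Dotv.

(** * The BFGS update of the Hessian approximation *)

Section BFGSUpdate.
Variables (R : realType) (n : nat).
Implicit Types (A B H : 'M[R]_n) (s y v : 'rV[R]_n).

(** The direct BFGS formula for [B = H^-1]. Vectors are rows, so [s *m B] is the transpose of the
    usual [B s] when [B] is symmetric. *)
Definition bfgsB B s y : 'M[R]_n :=
  B - (dotv (s *m B) s)^-1 *: ((s *m B)^T *m (s *m B))
    + (dotv s y)^-1 *: (y^T *m y).

Lemma posdef_dotv B v : posdef B -> v != 0 -> 0 < dotv (v *m B) v.
Proof. by move=> [_ +] v0; apply. Qed.

Lemma posdef_congr A B : posdef B -> A \in unitmx -> posdef (A *m B *m A^T).
Proof.
move=> [symB posB] uA; split=> [|v v0].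
  by rewrite !trmx_mul trmxK symB mulmxA.
have := posB (v *m A); rewrite trmx_mul !mulmxA; apply.
by apply: contra_neq v0 => /(congr1 (mulmx^~ (invmx A))); rewrite mulmxK // mul0mx.
Qed.

Lemma posdef_unitmx B : posdef B -> B \in unitmx.
Proof.
move=> [_ posB]; rewrite unitmxE unitfE; apply/det0P => -[v v0 vB].
by have := posB v v0; rewrite vB mul0mx mxE ltxx.
Qed.

Lemma posdef_invmx B : posdef B -> posdef (invmx B).
Proof.
move=> pB; have uB := posdef_unitmx pB; have [symB _] := pB.
have -> : invmx B = invmx B *m B *m (invmx B)^T.
  by rewrite mulVmx // mul1mx trmx_inv symB.
by apply: posdef_congr; rewrite ?unitmx_inv.
Qed.

(* The update is a congruence by a rank-one perturbation of the identity, so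
   it keeps definiteness and its determinant is explicit. *)
Lemma bfgsB_congr B s y : posdef B -> s != 0 -> 0 < dotv s y ->
  exists w, bfgsB B s y = (1%:M + w^T *m s) *m B *m (1%:M + w^T *m s)^T /\
    (1 + dotv s w) ^+ 2 = dotv s y / dotv (s *m B) s.
Proof.
move=> pB s0 sy0; have [symB _] := pB; have be0 := posdef_dotv pB s0.
set b := s *m B; set be := dotv b s; set si := dotv s y.
have [c c2] : exists c, c ^+ 2 = (be * si)^-1.
  by exists (Num.sqrt (be * si))^-1; rewrite exprVn sqr_sqrtr // mulr_ge0 // ltW.
have be_n0 : be != 0 by rewrite gt_eqF.
have si_n0 : si != 0 by rewrite gt_eqF.
(* Completing the square: the congruence gives [B - b^T b / be + be c^2 y^T y], and
   [be c^2 = 1 / si]. Moreover [1 + s.w = c si]. *)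
exists (c *: y - be^-1 *: b); split.
  rewrite [(1%:M + _)^T]linearD /= trmx1 trmx_mul trmxK mulmxDl mul1mx -mulmxA -/b.
  rewrite mulmxDr mulmx1 mulmxDl.
  have -> : B *m (s^T *m (c *: y - be^-1 *: b)) = b^T *m (c *: y - be^-1 *: b).
    by rewrite mulmxA /b trmx_mul symB.
  have siE : si^-1 = be * c ^+ 2 by rewrite c2 invfM mulrA divff // mul1r.
  rewrite outer_mulmx -/be /bfgsB -/b -/be -/si siE.
  move: b be be_n0 {be0 c2 siE pB symB} => b be be_n0.
  by apply/matrixP => i j; rewrite !(outerE, mxE); field.
rewrite dotvBr !dotvZr (dotvC s b) -/be -/si mulVf // addrC subrK exprMn c2.
by field; rewrite be_n0.
Qed.

Lemma bfgsB_posdef B s y : posdef B -> s != 0 -> 0 < dotv s y ->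
  posdef (bfgsB B s y).
Proof.
move=> pB s0 sy0; have [w [-> Ew]] := bfgsB_congr pB s0 sy0.
apply: posdef_congr => //; rewrite unitmxE unitfE det_rank_one_update.
by rewrite -sqrf_eq0 Ew gt_eqF // divr_gt0 // posdef_dotv.
Qed.

Lemma bfgsB_det B s y : posdef B -> s != 0 -> 0 < dotv s y ->
  \det (bfgsB B s y) = \det B * (dotv s y / dotv (s *m B) s).
Proof.
move=> pB s0 sy0; have [w [-> Ew]] := bfgsB_congr pB s0 sy0.
by rewrite !det_mulmx det_tr det_rank_one_update -Ew; ring.
Qed.

Lemma bfgsB_trace B s y : \tr (bfgsB B s y) =
  \tr B - dotv (s *m B) (s *m B) / dotv (s *m B) s + dotv y y / dotv s y.
Proof.
rewrite /bfgsB !mxtraceD [\tr (- _)]raddfN /= !mxtraceZ !mxtrace_outer.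
by rewrite ![_^-1 * _]mulrC.
Qed.

(** Links the recursion for [H] to the one for [B]. With [r = y H] and [b = s B], both factors
    become a matrix plus outer products, and the product collapses entrywise. *)
Lemma bfgsB_inverse B H s y : posdef B -> s != 0 -> 0 < dotv s y ->
  H *m B = 1%:M ->
  let V := 1%:M - (dotv s y)^-1 *: (s^T *m y) in
  (V *m H *m V^T + (dotv s y)^-1 *: (s^T *m s)) *m bfgsB B s y = 1%:M.
Proof.
move=> pB s0 sy0 HB V; have [symB _] := pB; have be0 := posdef_dotv pB s0.
have BH := mulmx1C HB.
have symH : H^T = H.
  by rewrite -[LHS]mul1mx -HB -mulmxA -[in B *m _]symB -trmx_mul HB trmx1 mulmx1.
set r := y *m H.
have HyE : H *m y^T = r^T by rewrite /r trmx_mul symH.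
have VHV : V *m H *m V^T = H - (dotv s y)^-1 *: (s^T *m r + r^T *m s)
    + ((dotv s y)^-1 ^+ 2 * dotv r y) *: (s^T *m s).
  rewrite /V [(1%:M - _)^T]linearB /= trmx1 [(_ *: _)^T]linearZ /= trmx_mul trmxK.
  rewrite mulmxBl mul1mx -scalemxAl -mulmxA -/r mulmxBr mulmx1 mulmxBl.
  rewrite -!scalemxAr mulmxA HyE -!scalemxAl outer_mulmx.
  by apply/matrixP => i j; rewrite !(outerE, mxE); ring.
set b := s *m B.
have HbE : H *m b^T = s^T by rewrite /b trmx_mul symB mulmxA HB mul1mx.
have rBE : r *m B = y by rewrite /r -mulmxA HB mulmx1.
have rbE : dotv r b = dotv s y.
  by rewrite /dotv /b trmx_mul symB mulmxA rBE -/(dotv y s) dotvC.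
have sBE : s *m B = b by [].
rewrite VHV /bfgsB -/b; rewrite sBE in be0.
clearbody b r; clear V VHV symB symH BH pB s0.
have be_n0 : dotv b s != 0 by rewrite gt_eqF.
have si_n0 : dotv s y != 0 by rewrite gt_eqF.
rewrite !mulmxDl !mulmxDr !mulNmx !mulmxN -!scalemxAl -!scalemxAr !mulmxDl.
rewrite !outer_mulmx -!(mulmxA _ _ B) rBE sBE HB !(mulmxA H) HbE HyE rbE.
rewrite (dotvC s b).
apply/matrixP => i j; rewrite !(outerE, mxE); field.
by rewrite si_n0 be_n0.
Qed.
End BFGSUpdate.

(** * Entries and determinant controlled by the trace *)

Section TraceBound.
Variables (R : realType) (n : nat).
Implicit Types (B : 'M[R]_n).

Lemma posdef_diag_gt0 B i : posdef B -> 0 < B i i.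
Proof.
move=> [_ /(_ (delta_mx 0 i))].
rewrite -rowE trmx_delta -colE !mxE; apply.
by apply/eqP => /matrixP /(_ 0 i); rewrite !mxE !eqxx => /eqP; rewrite oner_eq0.
Qed.

Lemma posdef_trace_ge0 B : posdef B -> 0 <= \tr B.
Proof. by move=> pB; apply: sumr_ge0 => i _; rewrite ltW // posdef_diag_gt0. Qed.

Lemma posdef_diag_le_trace B i : posdef B -> B i i <= \tr B.
Proof.
move=> pB; rewrite /mxtrace (bigD1 i) //= lerDl.
by apply: sumr_ge0 => j _; rewrite ltW // posdef_diag_gt0.
Qed.

Lemma posdef_psd B (v : 'rV[R]_n) : posdef B -> 0 <= (v *m B *m v^T) 0 0.
Proof.
move=> [_ pB]; have [->|/pB/ltW //] := eqVneq v 0.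
by rewrite !mul0mx mxE.
Qed.

(** Testing the form on [e_i + e_j] and [e_i - e_j] gives [2 |B i j| <= B i i + B j j]. *)
Lemma posdef_entry_le_trace B i j : posdef B -> `|B i j| <= \tr B.
Proof.
move=> pB; have symB : B j i = B i j by case: pB => {2}<- _; rewrite mxE.
pose d e : 'rV[R]_n := delta_mx 0 i + e *: delta_mx 0 j.
have E e : (d e *m B *m (d e)^T) 0 0 =
    B i i + e *+ 2 * B i j + e ^+ 2 * B j j.
  rewrite /d [(_ + _)^T]linearD /= [(_ *: _)^T]linearZ /= !trmx_delta !mulmxDl !mulmxDr.
  rewrite -!scalemxAl -!scalemxAr  -!rowE -!colE !mxE symB; ring.
have := posdef_psd (d 1) pB.
have := posdef_psd (d (-1)) pB.
rewrite !E => Hm Hp.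
have := posdef_diag_le_trace i pB; have := posdef_diag_le_trace j pB => Hj Hi.
by rewrite ler_norml; apply/andP; split; lra.
Qed.

(** Crude bound from the Leibniz expansion: only growth polynomial in the trace matters, not the
    constant [n!]. *)
Lemma posdef_det_le_trace B :
  posdef B -> `|\det B| <= #|{: 'S_n}|%:R * \tr B ^+ n.
Proof.
move=> pB; apply: le_trans (ler_norm_sum _ _ _) _.
rewrite mulr_natl -sumr_const; apply: ler_sum => s _.
rewrite normrM normrX normrN1 expr1n mul1r normr_prod.
have -> : \tr B ^+ n = \prod_(i < n) \tr B by rewrite prodr_const card_ord.
apply: ler_prod => i _.
by rewrite normr_ge0 posdef_entry_le_trace.
Qed.
End TraceBound.

(** * The counting argument on traces and determinants *)

Section PowellCounting.
Variable R : realType.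

Lemma natSr_le_exp2 k : k.+1%:R <= 2 ^+ k :> R.
Proof. by rewrite -natrX ler_nat ltn_expl. Qed.

(** Arithmetic-geometric mean inequality; for [k = 0] both sides are 1, whatever the value of the
    division by zero. *)
Lemma prod_le_mean_exp (E : nat -> R) k : (forall i, 0 <= E i) ->
  \prod_(i < k) E i <= ((\sum_(i < k) E i) / k%:R) ^+ k.
Proof.
move=> E0; have := @leif_AGM R 'I_k predT (E \o val) (fun i _ => E0 i).
by rewrite /= card_ord => -[].
Qed.

(* [la] is the multiplier in [s_k B_k = - la_k g_k], [a_k = - g_k . s_k],
   [T k] and [D k] are the trace of [B_k] and the modulus of its determinant. *)
Lemma powell_counting (n : nat) (T D la a : nat -> R) (M S C0 eps c : R) :
  0 < eps -> 0 < c -> 0 <= M -> 0 <= C0 -> 0 < D 0%N ->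
  (forall k, 0 < la k) -> (forall k, 0 < a k) -> (forall k, 0 <= T k) ->
  (forall k, \sum_(i < k) a i <= S) ->
  (forall k, T k.+1 <= T k + M - la k * eps / a k) ->
  (forall k, D k * c / la k <= D k.+1) ->
  (forall k, D k <= C0 * T k ^+ n) -> False.
Proof.
move=> eps0 c0 M0 C00 D0 la0 a0 T0 aS Trec Drec DT.
(* [K] dominates both [T 0] and [M], so summing the trace recursion costs at most [K] per step; the
   1 makes it positive. *)
pose K := T 0%N + M + 1.
have K0 : 0 < K by rewrite ltr_wpDl // addr_ge0.
have Tsum k : T k + \sum_(i < k) (la i * eps / a i) <= K * k.+1%:R.
  elim: k => [|k IH].
    by rewrite big_ord0 addr0 mulr1 /K -addrA lerDl addr_ge0.
  rewrite big_ord_recr /= -natr1 mulrDr mulr1.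
  have := Trec k; have MK : M <= K by rewrite /K addrAC lerDr addr_ge0.
  by move: IH; set q := la k * _ / _; set z := bigop _ _ _; lra.
have p0 i : 0 < la i * eps / a i by rewrite divr_gt0 // mulr_gt0.
have Tle k : T k <= K * k.+1%:R.
  apply: le_trans (Tsum k); rewrite lerDl.
  by apply: sumr_ge0 => i _; exact: ltW.
have psum k : \sum_(i < k) (la i * eps / a i) <= K * k.+1%:R.
  by apply: le_trans (Tsum k); rewrite lerDr.
(* The mean of the [k] factors is at most [K (k + 1) / k], hence at most [2 K] once [k] is
   positive. *)
have pprod k : \prod_(i < k) (la i * eps / a i) <= (2 * K) ^+ k.
  apply: le_trans (prod_le_mean_exp _ (fun i => ltW (p0 i))) _.
  case: k => [|k]; first by rewrite !expr0.
  rewrite lerXn2r ?nnegrE ?mulr_ge0 ?invr_ge0 ?ler0n ?(ltW K0) //.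
    by apply: sumr_ge0 => i _; exact: ltW.
  rewrite ler_pdivrMr ?ltr0n //; apply: le_trans (psum _) _.
  by rewrite (mulrC 2 K) -mulrA ler_pM2l // -natrM ler_nat; lia.
have Dprod k : D 0%N * c ^+ k <= D k * \prod_(i < k) la i.
  elim: k => [|k IH]; first by rewrite big_ord0.
  rewrite big_ord_recr /= exprSr mulrA.
  apply: le_trans (_ : D k * c / la k * (\prod_(i < k) la i * la k) <= _).
    rewrite [leRHS](_ : _ = D k * \prod_(i < k) la i * c).
      by rewrite ler_pM2r.
    by field; rewrite gt_eqF.
  rewrite ler_pM2r //; apply: mulr_gt0 => //; exact: prodr_gt0.
(* The polynomial factor [(k + 1)^n] is replaced by the geometric [(2^n)^k], so that only k-th
   powers remain to be compared. *)
have Dk k : D k <= C0 * K ^+ n * (2 ^+ n) ^+ k.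
  apply: le_trans (DT k) _; rewrite -mulrA ler_wpM2l //.
  rewrite exprAC -exprMn lerXn2r ?nnegrE ?T0 ?mulr_ge0 ?exprn_ge0 ?(ltW K0) //.
  by apply: le_trans (Tle k) _; rewrite ler_pM2l // natSr_le_exp2.
set E := C0 * K ^+ n in Dk; set Q := 2 ^+ n in Dk.
have E0 : 0 <= E by rewrite mulr_ge0 // exprn_ge0 // ltW.
have Q0 : 0 < Q by rewrite exprn_gt0.
clearbody E Q.
have S0 : 0 <= S by have := aS 0%N; rewrite big_ord0.
(* The product of the [la i] is eliminated between [Dprod] and [pprod]. The base on the right tends
   to 0 like [1 / k], because the [a i] have bounded sum. *)
have main k : D 0%N * (c * eps) ^+ k <= E * (Q * (2 * K) * (S / k%:R)) ^+ k.
  have A0 : 0 < \prod_(i < k) a i by exact: prodr_gt0.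
  have P0 : 0 < \prod_(i < k) la i by exact: prodr_gt0.
  have AS : \prod_(i < k) a i <= (S / k%:R) ^+ k.
    apply: le_trans (prod_le_mean_exp _ (fun i => ltW (a0 i))) _.
    rewrite lerXn2r ?nnegrE ?divr_ge0 ?ler0n //.
      by apply: sumr_ge0 => i _; exact: ltW.
    by rewrite ler_wpM2r ?invr_ge0.
  have LA : (\prod_(i < k) la i) * eps ^+ k <= (2 * K) ^+ k * \prod_(i < k) a i.
    rewrite -ler_pdivrMr //; apply: le_trans (pprod k).
    by rewrite prodf_div big_split /= prodr_const card_ord.
  rewrite [(c * eps) ^+ k]exprMn [D _ * _]mulrA.
  rewrite [(Q * (2 * K) * _) ^+ k]exprMn [(Q * (2 * K)) ^+ k]exprMn.
  apply: le_trans (_ : E * Q ^+ k * ((\prod_(i < k) la i) * eps ^+ k) <= _).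
    rewrite [leRHS]mulrA ler_pM2r ?exprn_gt0 //.
    by apply: le_trans (Dprod k) _; rewrite ler_pM2r.
  rewrite -!mulrA; apply: ler_wpM2l => //.
  apply: ler_wpM2l; first by rewrite exprn_ge0 // ltW.
  by apply: le_trans LA _; apply: ler_wpM2l => //; rewrite exprn_ge0 // mulr_ge0 // ltW.
(* From [N] on, the right-hand base is at most half of [c * eps], which leaves a factor [2 ^+ k] on
   the left. *)
pose N := (Num.truncn (Q * (2 * K) * S / (c * eps / 2))).+1.
have ce0 : 0 < c * eps by rewrite mulr_gt0.
have main2 k : (N <= k)%N -> D 0%N * 2 ^+ k <= E.
  move=> Nk; have k0 : (0 < k)%N by exact: leq_trans Nk.
  have Hk : Q * (2 * K) * (S / k%:R) <= c * eps / 2.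
    rewrite mulrA ler_pdivrMr ?ltr0n // -ler_pdivrMl ?divr_gt0 // mulrC.
    apply: ltW; apply: lt_le_trans (truncnS_gt _) _.
    by rewrite ler_nat.
  have H := le_trans (main k) (ler_wpM2l E0 (lerXn2r k _ _ Hk)).
  have {H} : D 0%N * (c * eps) ^+ k <= E * (c * eps / 2) ^+ k.
    apply: H; rewrite nnegrE; last by rewrite divr_ge0 // ltW.
    by rewrite !mulr_ge0 ?invr_ge0 ?(ltW Q0) ?(ltW K0).
  rewrite expr_div_n [leRHS]mulrA ler_pdivlMr ?exprn_gt0 // mulrAC.
  by rewrite ler_pM2r ?exprn_gt0.
pose k := maxn N (Num.truncn (E / D 0%N)).+1.
have := main2 k (leq_maxl _ _); apply/negP; rewrite -ltNge.
rewrite mulrC -ltr_pdivrMr //.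
apply: lt_le_trans (natSr_le_exp2 k).
apply: lt_le_trans (truncnS_gt _) _.
by rewrite ler_nat; apply: leqW; exact: leq_maxr.
Qed.
End PowellCounting.

(** * Powell's argument *)

Section Powell.
Variables (R : realType) (n : nat) (f : 'rV[R]_n -> R) (x : nat -> 'rV[R]_n).
Variables (H0 : 'M[R]_n) (nu C S : R).

Let g k := grad f (x k).
Let s k := x k.+1 - x k.
Let y k := g k.+1 - g k.
Let H := bfgsH f x H0.

Hypothesis posH0 : posdef H0.
Hypothesis nu_lt1 : nu < 1.
Hypothesis C_ge0 : 0 <= C.
Hypothesis g_neq0 : forall k, g k != 0.
Hypothesis direction :
  forall k, exists t, 0 <= t /\ H k *m (g k)^T = - (t *: (s k)^T).
Hypothesis wolfe : forall k, nu * dotv (g k) (s k) <= dotv (g k.+1) (s k).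
Hypothesis curvature : forall k, dotv (y k) (y k) <= C * dotv (s k) (y k).
Hypothesis descent : forall k, \sum_(i < k) - dotv (g i) (s i) <= S.

(** Defined by its own recursion rather than as [invmx (H k)], so that the trace and determinant
    formulas apply directly. *)
Fixpoint bfgsBs k : 'M[R]_n :=
  if k is k'.+1 then bfgsB (bfgsBs k') (s k') (y k') else invmx H0.

(** Inverting the direction condition gives [g k = - t s_k B_k]. Since [g k] is nonzero, neither [t]
    nor [s k] vanishes; then [la = 1 / t], and the Wolfe condition bounds [s.y] below. These facts
    make the next update legitimate in the induction that follows. *)
Lemma bfgs_step k : posdef (bfgsBs k) -> H k *m bfgsBs k = 1%:M ->
  [/\ s k != 0, 0 < - dotv (g k) (s k),
      (1 - nu) * - dotv (g k) (s k) <= dotv (s k) (y k) &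
      exists la, 0 < la /\ s k *m bfgsBs k = - (la *: g k)].
Proof.
move=> pB HB; have [t [t_ge0 Ht]] := direction k.
have gE : g k = - (t *: (s k *m bfgsBs k)).
  apply: trmx_inj; rewrite linearN linearZ /= trmx_mul (proj1 pB).
  by rewrite scalemxAr -mulmxN -Ht mulmxA (mulmx1C HB) mul1mx.
have t0 : t != 0.
  by apply: contraNneq (g_neq0 k) => t0; rewrite gE t0 scale0r oppr0.
have s0 : s k != 0.
  by apply: contraNneq (g_neq0 k) => s0; rewrite gE s0 mul0mx scaler0 oppr0.
have t_gt0 : 0 < t by rewrite lt_neqAle eq_sym t0.
have a0 : 0 < - dotv (g k) (s k).
  by rewrite gE dotvNl opprK dotvZl mulr_gt0 // posdef_dotv.
split=> //; last first.
  by exists t^-1; rewrite invr_gt0 gE scalerN opprK scalerA mulVf // scale1r.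
have -> : dotv (s k) (y k) = dotv (g k.+1) (s k) - dotv (g k) (s k).
  by rewrite dotvC dotvBl.
by have := wolfe k; lra.
Qed.

Lemma bfgsBs_inverse k : posdef (bfgsBs k) /\ H k *m bfgsBs k = 1%:M.
Proof.
elim: k => [|k [pB HB]] /=.
  by split; [exact: posdef_invmx | rewrite mulmxV // posdef_unitmx].
have [s0 a0 sya _] := bfgs_step pB HB.
have sy0 : 0 < dotv (s k) (y k).
  by apply: lt_le_trans sya; rewrite mulr_gt0 // subr_gt0.
split; first exact: bfgsB_posdef.
exact: bfgsB_inverse.
Qed.

Lemma bfgs_descent_direction k : 0 < - dotv (g k) (s k).
Proof. by have [pB HB] := bfgsBs_inverse k; have [] := bfgs_step pB HB. Qed.

Lemma bfgs_gradient_small eps : 0 < eps -> exists k, dotv (g k) (g k) < eps.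
Proof.
move=> eps0; apply: contrapT => nex.
have gge k : eps <= dotv (g k) (g k) by rewrite leNgt; apply/negP => ?; apply: nex; exists k.
have step k : [/\ s k != 0, 0 < - dotv (g k) (s k),
      (1 - nu) * - dotv (g k) (s k) <= dotv (s k) (y k) &
      exists la, 0 < la /\ s k *m bfgsBs k = - (la *: g k)].
  by have [pB HB] := bfgsBs_inverse k; exact: bfgs_step.
have /choice[la hla] k : exists la, 0 < la /\ s k *m bfgsBs k = - (la *: g k).
  by have [] := step k.
have nu0 : 0 < 1 - nu by rewrite subr_gt0.
have a0 := bfgs_descent_direction.
have sy0 k : 0 < dotv (s k) (y k).
  by have [_ _ + _] := step k; apply: lt_le_trans; rewrite mulr_gt0.
have beE k : dotv (s k *m bfgsBs k) (s k) = la k * - dotv (g k) (s k).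
  by rewrite (proj2 (hla k)) dotvNl dotvZl mulrN.
(* The curvature constant [C] bounds the trace increment, [n!] is the Leibniz constant, and [1 - nu]
   comes from the Wolfe condition. *)
apply: (@powell_counting R n (fun k => \tr (bfgsBs k))
  (fun k => `|\det (bfgsBs k)|) la (fun k => - dotv (g k) (s k)) C S
  #|{: 'S_n}|%:R eps (1 - nu)) => //.
- by rewrite normr_gt0 -unitfE -unitmxE; apply: posdef_unitmx; have [] := bfgsBs_inverse 0.
- by move=> k; have [] := hla k.
- by move=> k; apply: posdef_trace_ge0; have [] := bfgsBs_inverse k.
- move=> k /=; rewrite bfgsB_trace beE (proj2 (hla k)) dotvNl dotvNr opprK.
  rewrite dotvZl dotvZr.
  have l0 := proj1 (hla k); have := a0 k; set a := - dotv _ _ => ak.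
  have -> : la k * (la k * dotv (g k) (g k)) / (la k * a) = la k * dotv (g k) (g k) / a.
    by field; rewrite !gt_eqF.
  have : dotv (y k) (y k) / dotv (s k) (y k) <= C by rewrite ler_pdivrMr.
  have : la k * eps / a <= la k * dotv (g k) (g k) / a.
    by rewrite ler_pM2r ?invr_gt0 // ler_pM2l.
  lra.
- move=> k /=; have [pB _] := bfgsBs_inverse k; have [s0 _ sya _] := step k.
  rewrite bfgsB_det // normrM beE.
  have l0 := proj1 (hla k); have ak := a0 k.
  rewrite -mulrA ler_wpM2l // ger0_norm; last by rewrite divr_ge0 ?mulr_ge0 // ltW.
  rewrite ler_pdivlMr ?mulr_gt0 //.
  by rewrite (_ : _ / _ * _ = (1 - nu) * - dotv (g k) (s k)) //; field; rewrite gt_eqF.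
- by move=> k; apply: posdef_det_le_trace; have [] := bfgsBs_inverse k.
Qed.
End Powell.

(** * Convexity and quadratic upper bounds *)

Lemma mx_entry_le_norm (R : realType) m n (A : 'M[R]_(m, n)) i j :
  `|A i j| <= `|A|.
Proof.
have /= := mx_normrE A; rewrite [X in _ <= X]/Num.norm /= => ->.
exact: (le_bigmax _ (fun ij => `|A ij.1 ij.2|) (i, j)).
Qed.

(** * Jensen's inequality and supporting hyperplanes *)

Section Convexity.
Variables (R : realType) (n : nat) (U : set 'rV[R]_n) (f : 'rV[R]_n -> R).
Hypothesis cvxU : convex_set (U : set (convex_lmodType 'rV[R]_n)).
Hypothesis cvxf : convex_function (U : set (convex_lmodType 'rV[R]_n)) f.

Lemma convex_setD a b t : U a -> U b -> 0 <= t -> t <= 1 ->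
  U (t *: a + (1 - t) *: b).
Proof.
move=> Ua Ub t0 t1; have := @cvxU a b (Itv01 t0 t1); rewrite !inE.
by move=> /(_ Ua Ub).
Qed.

Lemma convex_functionD a b t : U a -> U b -> 0 <= t -> t <= 1 ->
  f (t *: a + (1 - t) *: b) <= t * f a + (1 - t) * f b.
Proof.
move=> Ua Ub t0 t1; have := @cvxf (Itv01 t0 t1) a b; rewrite !inE.
by move=> /(_ Ua Ub).
Qed.

(** Jensen's inequality with equal weights, by induction: a mean of [m + 1] points combines the new
    point, with weight [1 / (m + 1)], and the mean of the other [m]. *)
Lemma convex_mean (I : Type) (r : seq I) (P : I -> 'rV[R]_n) :
  (forall i, U (P i)) -> (0 < size r)%N ->
  U ((size r)%:R^-1 *: \sum_(i <- r) P i) /\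
  f ((size r)%:R^-1 *: \sum_(i <- r) P i)
    <= (size r)%:R^-1 * \sum_(i <- r) f (P i).
Proof.
move=> UP; elim: r => [//|i r IH] _; rewrite !big_cons.
have [/size0nil ->|r0] := posnP (size r).
  by rewrite !big_nil !addr0 invr1 scale1r mul1r.
have [//|Ur fr] := IH.
set m := size r in Ur fr *; rewrite -[size (i :: r)]/m.+1.
have m0 : m%:R != 0 :> R by rewrite pnatr_eq0 -lt0n.
have t0 : 0 <= m.+1%:R^-1 :> R by rewrite invr_ge0.
have t1 : m.+1%:R^-1 <= 1 :> R by rewrite invf_le1 ?ltr0n // ler1n.
have c1 : 1 - m.+1%:R^-1 = m%:R / m.+1%:R :> R.
  by rewrite -natr1; field; rewrite natr1 pnatr_eq0.
have E : m.+1%:R^-1 *: (P i + \sum_(j <- r) P j) = m.+1%:R^-1 *: P i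
    + (1 - m.+1%:R^-1) *: (m%:R^-1 *: \sum_(j <- r) P j).
  by rewrite scalerDr scalerA c1 mulrAC divff // mul1r.
rewrite E; split; first exact: convex_setD.
apply: le_trans (convex_functionD _ _ t0 t1) _ => //.
rewrite mulrDr lerD2l.
apply: le_trans (ler_wpM2l _ fr) _; first by rewrite subr_ge0.
by rewrite c1 mulrA (mulrAC m%:R) divff // mul1r.
Qed.

Lemma derive_grad a v : differentiable f a -> 'D_v f a = dotv (grad f a) v.
Proof.
move=> df; rewrite deriveE // {1}(row_sum_delta v) linear_sum dotvE.
apply: eq_bigr => i _; rewrite linearZ /= mxE deriveE //.
by rewrite mulrC.
Qed.

(** For [0 < h <= 1] the difference quotient along [b - a] is at most [f b - f a]; let [h] decrease
    to 0. *)
Lemma convex_gradient_ineq a b : U a -> U b -> differentiable f a ->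
  f a + dotv (grad f a) (b - a) <= f b.
Proof.
move=> Ua Ub df; rewrite -lerBrDl -derive_grad //.
have : derivable f a (b - a) by exact: diff_derivable.
rewrite /derivable => /cvg_dnbhs_at_right cv.
apply: (cvgr_to_le cv); near=> h.
have h0 : 0 < h by near: h; exact: nbhs_right_gt.
have h1 : h <= 1 by near: h; exact: nbhs_right_le.
rewrite /= /shift /= ler_pdivrMl // [leRHS]mulrC.
have -> : h *: (b - a) + a = h *: b + (1 - h) *: a.
  by rewrite scalerBr scalerBl scale1r addrAC addrA addrAC.
have := convex_functionD Ub Ua (ltW h0) h1; lra.
Unshelve. all: by end_near. Qed.
End Convexity.

(** * Second-order bounds along a line *)

Section LocalBound.
Variables (R : realType) (n : nat).
Implicit Types (f : 'rV[R]_n -> R) (p q h e : 'rV[R]_n).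

Lemma rV_ballP p q d : 0 < d ->
  ball p d q <-> forall i, `|q 0 i - p 0 i| < d.
Proof.
move=> d0; split=> [[_ pq] i|pq]; first by rewrite distrC; exact: (pq 0 i).
by split=> // i j; rewrite ord1 /ball /= distrC; exact: pq.
Qed.

Lemma derivable_line (F : 'rV[R]_n -> R) q e (u : R) :
  derivable F (q + u *: e) e ->
  is_derive u 1 (fun t : R => F (q + t *: e)) ('D_e F (q + u *: e)).
Proof.
have E : (fun h : R => h^-1 *: ((F \o shift (q + u *: e)) (h *: e) - F (q + u *: e)))
  = (fun h : R => h^-1 *: (((fun t : R => F (q + t *: e)) \o shift u) (h *: 1)
      - F (q + u *: e))).
  apply/funext => h /=; congr (_ *: (F _ - _)).
  by rewrite /shift /= [_ *: (1 : R)]mulr1 scalerDl addrCA.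
by move=> dF; apply: DeriveDef; rewrite /derivable /derive -E.
Qed.

(** Writing the intermediate point as [c * tau] with [c] in [0, 1] treats both signs of [tau], and
    0, uniformly. *)
Lemma line_MVT (F : 'rV[R]_n -> R) q e (tau : R) :
  (forall u : R, `|u| <= `|tau| -> derivable F (q + u *: e) e) ->
  exists c, [/\ 0 <= c, c <= 1 &
    F (q + tau *: e) - F q = tau * 'D_e F (q + (c * tau) *: e)].
Proof.
move=> dF.
have is_d (u : R) : `|u| <= `|tau| ->
    is_derive u 1 (fun t : R => F (q + t *: e)) ('D_e F (q + u *: e)).
  by move=> /dF; exact: derivable_line.
have [->|tau0] := eqVneq tau 0.
  by exists 0; rewrite scale0r addr0 subrr mul0r.
have conv a b : (forall u, u \in `[a, b] -> `|u| <= `|tau|) ->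
    {within `[a, b], continuous (fun t : R => F (q + t *: e))}.
  by move=> ab; apply: derivable_within_continuous => u /ab /is_d [].
have [neg|pos|eq0] := ltgtP tau 0; last by rewrite eq0 eqxx in tau0.
- have Hab u : u \in `[tau, 0] -> `|u| <= `|tau|.
    by rewrite in_itv /= => /andP[u1 u2]; rewrite !ler0_norm ?lerN2 // ltW.
  have [|c] := @MVT_segment R _ (fun t => 'D_e F (q + t *: e)) _ _ (ltW neg) _ (conv _ _ Hab).
    by move=> u uin; apply: is_d; apply: Hab; exact: subset_itv_oo_cc uin.
  rewrite in_itv /= scale0r addr0 => /andP[c1 c2] Ec.
  exists (c / tau); rewrite divfK // ler_ndivlMr // ler_ndivrMr // mul0r mul1r.
  split=> //; rewrite -opprB Ec; ring.
- have Hab u : u \in `[0, tau] -> `|u| <= `|tau|.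
    by rewrite in_itv /= => /andP[u1 u2]; rewrite !ger0_norm // ltW.
  have [|c] := @MVT_segment R _ (fun t => 'D_e F (q + t *: e)) _ _ (ltW pos) _ (conv _ _ Hab).
    by move=> u uin; apply: is_d; apply: Hab; exact: subset_itv_oo_cc uin.
  rewrite in_itv /= scale0r addr0 => /andP[c1 c2] Ec.
  exists (c / tau); rewrite divfK // ler_pdivlMr // ler_pdivrMr // mul0r mul1r.
  by split=> //; rewrite Ec; ring.
Qed.

(** The mean value theorem applied to [f], then to ['D_e f], leaves the remainder
    [c * D2 * tau ^+ 2] with [c] in [0, 1]. The maximum with 0 absorbs [c] when [L] is negative. *)
Lemma line_quadratic_bound f q e (tau L : R) :
  (forall u : R, `|u| <= `|tau| -> [/\ derivable f (q + u *: e) e,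
     derivable ('D_e f) (q + u *: e) e & 'D_e ('D_e f) (q + u *: e) <= L]) ->
  f (q + tau *: e) <= f q + tau * 'D_e f q + Num.max L 0 * tau ^+ 2.
Proof.
move=> Hu.
have [|c [c0 c1 Ec]] := @line_MVT f q e tau; first by move=> u /Hu[].
have ctau : `|c * tau| <= `|tau| by rewrite normrM (ger0_norm c0) ler_piMl.
have [|d [d0 d1 Ed]] := @line_MVT ('D_e f) q e (c * tau).
  by move=> u uc; have [] := Hu u (le_trans uc ctau).
have [|_ _ dL] := Hu (d * (c * tau)).
  by rewrite normrM (ger0_norm d0); apply: le_trans ctau; rewrite ler_piMl.
set D2 := 'D_e ('D_e f) _ in Ed dL.
have -> : f (q + tau *: e) = f q + tau * 'D_e f q + c * D2 * tau ^+ 2.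
  by move/eqP: Ec; rewrite subr_eq => /eqP ->; move/eqP: Ed; rewrite subr_eq => /eqP ->; ring.
rewrite lerD2l ler_wpM2r ?sqr_ge0 //.
have : c * D2 <= c * Num.max L 0 by rewrite ler_wpM2l // le_max dL.
move/le_trans; apply; rewrite ler_piMl // le_max lexx orbT //.
Qed.
End LocalBound.

(** * Quadratic upper model, uniform on compact sets *)

Section UniformBound.
Variables (R : realType) (n : nat) (U V : set 'rV[R]_n) (f : 'rV[R]_n -> R).
Hypothesis cvxU : convex_set (U : set (convex_lmodType 'rV[R]_n)).
Hypothesis cvxf : convex_function (U : set (convex_lmodType 'rV[R]_n)) f.
Hypothesis openV : open V.
Hypothesis VU : V `<=` U.
Hypothesis hessV : forall y, V y ->
  hessian_exists f y /\ {for y, continuous (hessian f)}.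

Lemma hessian_diag_locally_bounded p : V p ->
  exists2 r : R, 0 < r & exists2 L : R, 0 <= L &
    forall q, ball p r q -> V q /\ forall i, hessian f q i i <= L.
Proof.
move=> Vp; have [_ cH] := hessV Vp.
have /(cvgr_norm_le)/(_ (`|hessian f p| + 1)) := cH.
rewrite ltrDl ltr01 => /(_ isT) nH.
have nV : nbhs p V by exact: open_nbhs_nbhs.
have /nbhs_ballP[r /= r0 rP] :
  nbhs p ([set q | `|hessian f q| <= `|hessian f p| + 1] `&` V) by exact: filterI.
exists r => //; exists (`|hessian f p| + 1); first by rewrite addr_ge0.
move=> q /rP[/= Hq Vq]; split=> // i.
apply: le_trans (ler_norm _) _; apply: le_trans Hq.
exact: mx_entry_le_norm.
Qed.

(* Convexity lets one average over the coordinate directions, so that only the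
   diagonal entries of the Hessian matter. *)
Lemma local_quadratic_bound p : V p -> (0 < n)%N ->
  exists2 d : R, 0 < d & exists2 L : R, 0 <= L & forall q h : 'rV[R]_n, ball p d q ->
    (forall i, `|h 0 i| < d) ->
    V (q + h) /\ f (q + h) <= f q + dotv (grad f q) h + L * dotv h h.
Proof.
move=> Vp n0; have [r r0 [L L0 rP]] := hessian_diag_locally_bounded Vp.
have nr0 : 0 < n%:R :> R by rewrite ltr0n.
have n1 : 1 <= n%:R :> R by rewrite ler1n.
(* The averaged points move by [n * h 0 i] along one axis, so [n * d = r / 2] keeps them within [r]
   of [p]. Averaging the squares [(n * h 0 i)^2] turns [L] into [n * L]. *)
pose d := r / 2 / n%:R.
have d0 : 0 < d by rewrite !divr_gt0.
have nd : n%:R * d = r / 2 by rewrite /d mulrC divfK // gt_eqF.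
have dr : d <= r / 2 by rewrite -nd ler_peMl // ltW.
exists d => //; exists (n%:R * L); first by rewrite mulr_ge0.
move=> q h /(rV_ballP _ _ d0) pq hd.
have ballh (u : 'rV[R]_n) : (forall i, `|u 0 i| < r / 2) -> ball p r (q + u).
  move=> ur; apply/rV_ballP => // i; rewrite mxE addrAC.
  apply: le_lt_trans (ler_normD _ _) _; have := ur i; have := pq i; lra.
split.
  by apply: (rP _ _).1; apply: ballh => i; exact: lt_le_trans (hd i) dr.
have ballt i (u : R) : `|u| <= `|n%:R * h 0 i| -> ball p r (q + u *: ebasis _ i).
  move=> ule; apply: ballh => j; rewrite !mxE eqxx /=.
  apply: le_lt_trans (_ : `|u| < _).
    by case: (j == i); rewrite ?mulr1 ?mulr0 ?normr0.
  apply: le_lt_trans ule _; rewrite normrM gtr0_norm // -nd ltr_pM2l //.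
pose P (i : 'I_n) := q + (n%:R * h 0 i) *: ebasis _ i.
have UP i : U (P i) by apply: VU; apply: (rP _ _).1; exact: ballt.
have sz : size (index_enum 'I_n) = n.
  by rewrite -sum1_size -[RHS]card_ord -sum1_card; exact: eq_bigl.
have [|_] := convex_mean cvxU cvxf UP (r := index_enum 'I_n); first by rewrite sz.
rewrite sz.
have -> : n%:R^-1 *: \sum_i P i = q + h.
  rewrite big_split /= sumr_const card_ord -(scaler_nat _ q) scalerDr scalerA mulVf ?gt_eqF //.
  rewrite scale1r scaler_sumr; congr (_ + _).
  rewrite [RHS]row_sum_delta; apply: eq_bigr => i _.
  by rewrite scalerA mulrA mulVf ?gt_eqF // mul1r.
move/le_trans; apply.
rewrite ler_pdivrMl //.
have -> : n%:R * (f q + dotv (grad f q) h + n%:R * L * dotv h h) =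
    \sum_i (f q + n%:R * h 0 i * grad f q 0 i + L * (n%:R * h 0 i) ^+ 2).
  rewrite !big_split /= sumr_const card_ord -[f q *+ _]mulr_natl !mulrDr !dotvE !mulr_sumr.
  by congr (_ + _ + _); apply: eq_bigr => i _; ring.
apply: ler_sum => i _; rewrite /P mxE -{1}(max_idPl L0).
apply: line_quadratic_bound => u /ballt /rP[Vu Hu].
have [[d1 d2] _] := hessV Vu; split=> //.
by have := Hu i; rewrite mxE.
Qed.

(** Near-covering compactness with a single integer [m] governing both the radius [1 / (m + 1)] and
    the constants. The third bound, on [f] itself, serves to bound gradients. *)
Lemma compact_quadratic_bound (K : set 'rV[R]_n) : compact K -> K `<=` V ->
  (0 < n)%N -> exists2 d : R, 0 < d & exists2 L : R, 0 <= L &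
    forall q h : 'rV[R]_n, K q -> (forall i, `|h 0 i| < d) ->
    [/\ V (q + h), f (q + h) <= f q + dotv (grad f q) h + L * dotv h h &
        f (q + h) <= L].
Proof.
move=> /compact_near_coveringP cK KV n0.
pose P (m : nat) (q : 'rV[R]_n) := forall h : 'rV[R]_n,
  (forall i, `|h 0 i| < m.+1%:R^-1) ->
  [/\ V (q + h), f (q + h) <= f q + dotv (grad f q) h + m%:R * dotv h h &
      f (q + h) <= m%:R].
have [] := cK nat \oo P _.
  move=> p /KV Vp; have [d d0 [L L0 dP]] := local_quadratic_bound Vp n0.
  (* [M] bounds [f] on the ball of radius [d] around [p], by the model centred at [p]. [N] then
     exceeds [L], [M] and [2 / d]. *)
  pose M := f p + \sum_i `|grad f p 0 i| * d + L * (n%:R * d ^+ 2).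
  have d20 : 0 < d / 2 by rewrite divr_gt0.
  pose N := (Num.truncn (L + `|M| + 2 / d)).+1.
  exists (ball p (d / 2), [set m | (N <= m)%N]) => /=.
    by split; [exact: nbhsx_ballx | exists N].
  move=> [q m] /= [pq Nm] h hm.
  have mb : L + `|M| + 2 / d < m%:R.
    by apply: lt_le_trans (truncnS_gt _) _; rewrite ler_nat.
  have td : 0 < 2 / d by rewrite divr_gt0.
  have nM := normr_ge0 M.
  have md : m.+1%:R^-1 <= d / 2.
    rewrite -[d / 2]invrK lef_pV2 ?posrE ?invr_gt0 //.
    by rewrite invf_div -natr1; lra.
  have hd i : `|h 0 i| < d / 2 by exact: lt_le_trans (hm i) md.
  have [|//|Vqh qh] := dP q h.
    by apply: le_ball pq; lra.
  - by move=> i; have := hd i; lra.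
  move/(rV_ballP _ _ d20) : pq => pq.
  split=> //.
    apply: le_trans qh _; rewrite lerD2l ler_wpM2r ?dotvv_ge0 //; lra.
  pose h' := q + h - p.
  have h'd i : `|h' 0 i| < d.
    rewrite !mxE addrAC; apply: le_lt_trans (ler_normD _ _) _.
    by have := hd i; have := pq i; lra.
  have [||_] := dP p h'; [exact: ballxx|exact: h'd|].
  rewrite /h' addrC subrK -/h' => /le_trans; apply.
  apply: le_trans (_ : M <= _); last by have := ler_norm M; lra.
  rewrite /M lerD // ?lerD2l.
    rewrite dotvE; apply: ler_sum => i _.
    apply: le_trans (ler_norm _) _; rewrite normrM ler_wpM2l // ltW //.
  rewrite ler_wpM2l // dotvE mulr_natl -[n in _ *+ n]card_ord -sumr_const.
  apply: ler_sum => i _; rewrite -expr2 -real_normK ?num_real //.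
  apply: lerXn2r; rewrite ?nnegrE ?normr_ge0 //; first exact: ltW.
  exact: ltW (h'd i).
move=> N _ /(_ N (leqnn N)) KP.
exists N.+1%:R^-1; first by rewrite invr_gt0.
by exists N%:R => // q h /KP; apply.
Qed.
End UniformBound.

(** * Gradient bound and curvature inequality *)

Section Curvature.
Variables (R : realType) (n : nat) (U : set 'rV[R]_n) (f : 'rV[R]_n -> R).
Hypothesis cvxf : convex_function (U : set (convex_lmodType 'rV[R]_n)) f.

(** The supporting hyperplane at [a] is evaluated at [a] plus or minus [d / 2] times a basis
    vector. *)
Lemma convex_gradient_bound (a : 'rV[R]_n) (d m M : R) : 0 < d ->
  U a -> differentiable f a -> m <= f a ->
  (forall h : 'rV[R]_n, (forall i, `|h 0 i| < d) -> U (a + h) /\ f (a + h) <= M) ->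
  forall i, `|grad f a 0 i| <= (M - m) / (d / 2).
Proof.
move=> d0 Ua df fm hM i.
have key (e : R) : `|e| = d / 2 -> e * grad f a 0 i <= M - m.
  move=> ed; have [|Uh fh] := hM (e *: ebasis _ i).
    move=> j; rewrite !mxE eqxx /= normrM ed.
    by case: (j == i); rewrite ?normr1 ?normr0; lra.
  have := convex_gradient_ineq cvxf Ua Uh df.
  by rewrite [a + _ - a]addrAC subrr add0r dotvZr dotv_ebasis; lra.
have d20 : 0 < d / 2 by lra.
rewrite ler_pdivlMr // mulrC.
have [gi|gi] := lerP 0 (grad f a 0 i).
  by rewrite ger0_norm //; apply: key; rewrite gtr0_norm.
by rewrite ltr0_norm // mulrN -mulNr; apply: key; rewrite normrN gtr0_norm.
Qed.

(* The upper quadratic model at [a] and the supporting hyperplane at [b] are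
   compared at [a + t (grad f b - grad f a)]. *)
Lemma convex_curvature_bound (a b : 'rV[R]_n) (d L G : R) :
  0 < d -> 0 <= L -> 0 <= G ->
  U a -> U b -> differentiable f a -> differentiable f b ->
  (forall i, `|grad f a 0 i| <= G) -> (forall i, `|grad f b 0 i| <= G) ->
  (forall h : 'rV[R]_n, (forall i, `|h 0 i| < d) ->
     U (a + h) /\ f (a + h) <= f a + dotv (grad f a) h + L * dotv h h) ->
  dotv (grad f b - grad f a) (grad f b - grad f a)
    <= 2 * (2 * G / d + 2 * L + 1) * dotv (b - a) (grad f b - grad f a).
Proof.
move=> d0 L0 G0 Ua Ub da db Ga Gb quad.
set y := grad f b - grad f a; set c := 2 * G / d + 2 * L + 1.
have Gd0 : 0 <= 2 * G / d by rewrite divr_ge0 ?mulr_ge0 // ltW.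
have c0 : 0 < c by rewrite /c; lra.
(* The choice of [c] ensures both that [t *: y] has entries below [d] and that [L * t <= 1 / 2]. *)
pose t := c^-1; have t0 : 0 < t by rewrite invr_gt0.
have ct : c * t = 1 by rewrite divff // gt_eqF.
have [|Uh fh] := quad (t *: y).
  move=> i; rewrite mxE normrM gtr0_norm // /t mulrC ltr_pdivrMr //.
  have yG : `|y 0 i| <= 2 * G.
    rewrite !mxE; apply: le_trans (ler_normB _ _) _.
    have := Ga i; have := Gb i; rewrite !mxE; lra.
  apply: le_lt_trans yG _; rewrite -ltr_pdivrMl // mulrC /c; lra.
have H1 := convex_gradient_ineq cvxf Ub Uh db.
have H2 := convex_gradient_ineq cvxf Ua Ub da.
have yy0 := dotvv_ge0 y.
have E1 : dotv (grad f b) (a + t *: y - b)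
    = - dotv (grad f b) (b - a) + t * dotv (grad f b) y.
  have -> : a + t *: y - b = - (b - a) + t *: y by rewrite opprB addrAC.
  by rewrite [LHS]dotvDr dotvNr dotvZr.
have E2 : dotv (b - a) y = dotv (grad f b) (b - a) - dotv (grad f a) (b - a).
  by rewrite dotvC dotvBl.
have E3 : dotv y y = dotv (grad f b) y - dotv (grad f a) y by rewrite -dotvBl.
move: fh; rewrite !dotvZr dotvZl => fh; rewrite E1 in H1.
have Lt : L * t <= 1 / 2.
  by rewrite /t ler_pdivrMr // /c; lra.
(* Adding [H1], [H2] and [fh] cancels all values of [f]; the last term is then absorbed on the
   left. *)
have H3 : t * dotv y y <= dotv (b - a) y + L * t * (t * dotv y y).
  by rewrite E2 {1}E3; lra.
have H4 : L * t * (t * dotv y y) <= 1 / 2 * (t * dotv y y).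
  by rewrite ler_wpM2r // mulr_ge0 // ltW.
have H5 : t * dotv y y <= 2 * dotv (b - a) y by lra.
rewrite [leLHS](_ : _ = c * (t * dotv y y)); last by rewrite mulrA ct mul1r.
by rewrite (mulrC 2 c) -mulrA ler_pM2l.
Qed.
End Curvature.

(** * Convergence of the function values *)

Theorem theorem3p2 (R : realType) (n : nat) (U V : set 'rV[R]_n)
  (f : 'rV[R]_n -> R) (x : nat -> 'rV[R]_n) :
  open U -> convex_set (U : set (convex_lmodType 'rV[R]_n)) ->
  convex_function (U : set (convex_lmodType 'rV[R]_n)) f ->
  BFGS_sequence f x ->
  (forall k, U (x k)) ->
  bounded_set [set y | U y /\ f y <= f (x 0%N)] ->
  open V -> V `<=` U -> closure (range x) `<=` V ->
  ereal_inf [set (f y)%:E | y in V] = ereal_inf [set (f y)%:E | y in U] ->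
  (forall y, V y -> hessian_exists f y /\ posdef (hessian f y) /\
     {for y, continuous (hessian f)}) ->
  (fun k => (f (x k))%:E) @ \oo --> ereal_inf [set (f y)%:E | y in U].
Proof.
move=> _ cvxU cvxf [hd [mu [nu [H0 [mu0 munu nu1 pH0 hk]]]]] Ux bU oV VU KV _ hV.
have df k : differentiable f (x k) by have [] := hd k.
have g0 k : grad f (x k) != 0 by have [] := hd k.
have dir k : exists t : R, 0 <= t /\
    bfgsH f x H0 k *m (grad f (x k))^T = - (t *: (x k.+1 - x k)^T).
  by have [] := hk k.
have armijo k : f (x k.+1) <= f (x k) + mu * dotv (grad f (x k)) (x k.+1 - x k).
  by have [] := hk k.
have wolfe k : nu * dotv (grad f (x k)) (x k.+1 - x k)
    <= dotv (grad f (x k.+1)) (x k.+1 - x k) by have [] := hk k.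
have a0 := bfgs_descent_direction pH0 nu1 g0 dir wolfe.
(* In dimension 0 the gradient would vanish. *)
have n0 : (0 < n)%N.
  by rewrite lt0n; apply: contraNneq (g0 0%N) => n0; subst n; rewrite thinmx0.
have nr0 : 0 < n%:R :> R by rewrite ltr0n.
have dec1 k : f (x k.+1) <= f (x k).
  apply: le_trans (armijo k) _; rewrite gerDl; have := mulr_gt0 mu0 (a0 k); lra.
have dec : {homo f \o x : i j / (i <= j)%N >-> j <= i}.
  by apply/nonincreasing_seqP => k; exact: dec1.
have [D D0 hD] := pinfty_ex_gt0 bU.
have {}hD z : U z -> f z <= f (x 0%N) -> `|z| <= D by move=> Uz fz; exact: hD.
have xD k : `|x k| <= D by apply: hD => //; exact: dec.
have distD z k i : U z -> f z <= f (x 0%N) -> `|(z - x k) 0 i| <= 2 * D.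
  move=> Uz /(hD _ Uz) zD; apply: le_trans (mx_entry_le_norm _ _ _) _.
  by apply: le_trans (ler_normB _ _) _; have := xD k; lra.
(* Lower bound for [f] on the iterates, from the supporting hyperplane at [x 0]. *)
pose m := f (x 0%N) - (\sum_i `|grad f (x 0%N) 0 i|) * (2 * D).
have fm k : m <= f (x k).
  have := convex_gradient_ineq cvxf (Ux 0%N) (Ux k) (df 0%N).
  have := dotv_norm_le (grad f (x 0%N)) (fun i => distD _ 0%N i (Ux k) (dec _ _ (leq0n k))).
  by rewrite ler_norml /m => /andP[]; lra.
pose K := closure (range x).
have cK : compact K.
  apply: bounded_closed_compact; last exact: closed_closure.
  have KD y : K y -> `|y| <= D.
    rewrite /K closureEbigcap => /(_ (closed_ball_ Num.norm 0 D)).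
    rewrite /closed_ball_ /= sub0r normrN; apply; split.
      exact: closed_closed_ball_.
    by move=> _ [k _ <-]; rewrite /= sub0r normrN.
  exists D; split; first exact: num_real.
  by move=> M /ltW DM y /KD /le_trans; apply.
have hV' y : V y -> hessian_exists f y /\ {for y, continuous (hessian f)}.
  by move=> /hV[? []].
have [d d0 [L L0 KL]] := compact_quadratic_bound cvxU cvxf oV VU hV' cK KV n0.
have Kx k : K (x k) by apply: subset_closure; exists k.
pose G := (L - m) / (d / 2).
have gG k i : `|grad f (x k) 0 i| <= G.
  apply: (convex_gradient_bound cvxf d0 (Ux k) (df k) (fm k)) => h hh.
  by have [/VU] := KL _ _ (Kx k) hh.
have G0 : 0 <= G by apply: le_trans (gG 0%N (Ordinal n0)).
clearbody G.
pose C := 2 * (2 * G / d + 2 * L + 1).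
have C0 : 0 <= C.
  have : 0 <= 2 * G / d by rewrite divr_ge0 ?mulr_ge0 // ltW.
  by rewrite /C; lra.
have curv k : dotv (grad f (x k.+1) - grad f (x k)) (grad f (x k.+1) - grad f (x k))
    <= C * dotv (x k.+1 - x k) (grad f (x k.+1) - grad f (x k)).
  apply: (convex_curvature_bound cvxf d0 L0 G0) => // h hh.
  by have [/VU] := KL _ _ (Kx k) hh.
(* The Armijo decreases telescope, and [f] is bounded below by [m] along the sequence. *)
have desc k : \sum_(i < k) - dotv (grad f (x i)) (x i.+1 - x i)
    <= (f (x 0%N) - m) / mu.
  rewrite ler_pdivlMr //.
  suff : (\sum_(i < k) - dotv (grad f (x i)) (x i.+1 - x i)) * mu
      <= f (x 0%N) - f (x k) by have := fm k; lra.
  elim: k => [|k IH]; first by rewrite big_ord0 mul0r subrr.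
  by rewrite big_ord_recr /= mulrDl; have := armijo k; lra.
have gsmall := bfgs_gradient_small pH0 nu1 C0 g0 dir wolfe curv desc.
have approx z eta : U z -> 0 < eta -> exists k, f (x k) <= f z + eta.
  move=> Uz eta0; have [fz|fz] := leP (f z) (f (x 0%N)); last first.
    by exists 0%N; rewrite ltW // (lt_trans fz) // ltrDl.
  (* If every entry of the gradient is at most [e], the hyperplane at [x k] varies by at most
     [n * e * (2 * D) = eta] between [x k] and [z]. *)
  pose e := eta / (n%:R * (2 * D)).
  have e0 : 0 < e by rewrite divr_gt0 // !mulr_gt0.
  have [k gk] := gsmall (e ^+ 2) (exprn_gt0 _ e0); exists k.
  have ge i : `|grad f (x k) 0 i| <= e.
    rewrite -(ger0_norm (ltW e0)) -ler_sqr ?nnegrE // !real_normK ?num_real //.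
    exact: le_trans (sqr_coord_le_dotvv _ _) (ltW gk).
  have := convex_gradient_ineq cvxf (Ux k) Uz (df k).
  have := dotv_norm_le (grad f (x k)) (fun i => distD _ k i Uz fz).
  have : (\sum_i `|grad f (x k) 0 i|) * (2 * D) <= eta.
    rewrite (_ : eta = \sum_(i < n) e * (2 * D)); last first.
      rewrite sumr_const card_ord -mulr_natl /e.
      by field; rewrite !gt_eqF.
    by rewrite mulr_suml; apply: ler_sum => i _; rewrite ler_pM2r // mulr_gt0.
  by rewrite ler_norml => ? /andP[]; lra.
(* A nonincreasing sequence tends to the infimum of its values, so only the two infima remain to be
   identified. *)
have -> : ereal_inf [set (f y)%:E | y in U] = ereal_inf (range (fun k => (f (x k))%:E)).
  apply/eqP; rewrite eq_le; apply/andP; split.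
    apply/ereal_infP => _ [k _ <-]; apply: ereal_inf_lbound; exists (x k) => //.
  apply/ereal_infP => _ [z Uz <-]; apply/lee_addgt0Pr => eta eta0.
  have [k fk] := approx z eta Uz eta0.
  apply: le_trans (_ : ((f (x k))%:E <= _)%E); last by rewrite -EFinD lee_fin.
  by apply: ereal_inf_lbound; exists k.
by apply: ereal_nonincreasing_cvgn => i j ij; rewrite lee_fin; exact: dec.
Qed.
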